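(* Let $\Lambda$ be a finite or countable alphabet with $\#\Lambda\ge2$ and let $\mu$ be any shift-invariant probability measure on $\Lambda^{\mathbb N}$. If an infinite set $S\subset\mathbb N$ is superficial, then $S$ does not destroy $\mu$-normality; that is, there exists a $\mu$-normal $x\in\Lambda^{\mathbb N}$ such that $x|_S$ is also $\mu$-normal.
   Context: $\sigma$ is the left shift on $\Lambda^{\mathbb N}$. A point $x$ is generic for (equivalently, $\mu$-normal) a shift-invariant measure $\mu$ if $\frac1n\sum_{i=0}^{n-1}\delta_{\sigma^ix}\to\mu$ weak-*; equivalently, every finite block $B$ occurs in $x$ with limiting frequency $\mu([B])$, where $[B]$ is the cylinder of sequences beginning with $B$. For $S=\{s_1<s_2<\dots\}$ infinite, $x|_S=(x_{s_1},x_{s_2},\dots)$. $S$ destroys $\mu$-normality if $x|_S$ is not $\mu$-normal for every $\mu$-normal $x$. With $y=\mathbbm 1_S$ and $\mathcal M_y$ the set of shift-invariant measures quasi-generated by $y$ (weak-* accumulation points of $\frac1n\sum_{i<n}\delta_{\sigma^iy}$), $S$ is superficial if $\mathcal M_y\subset\mathrm{conv}\{\delta_{\bar0},\delta_{\bar1}\}$, where $\delta_{\bar0},\delta_{\bar1}$ are point masses at the constant sequences $(0,0,\dots)$, $(1,1,\dots)$. *)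

(* Defs.v *)
From mathcomp Require Import all_boot all_order all_algebra.
From mathcomp Require Import all_classical all_reals all_analysis.
Set Implicit Arguments. Unset Strict Implicit. Unset Printing Implicit Defensive.
Import Order.TTheory GRing.Theory Num.Theory numFieldNormedType.Exports.
Local Open Scope classical_set_scope.
Local Open Scope ring_scope.

Definition shift (L : Type) (x : nat -> L) : nat -> L := fun n => x n.+1.

Definition cyl (L : Type) (B : seq L) : set (nat -> L) :=
  [set x | mkseq x (size B) = B].

Definition cylinders (L : Type) : set (set (nat -> L)) :=
  [set cyl B | B in [set: seq L]].

(* L^N with the sigma-algebra generated by cylinders
   (= Borel sigma-algebra of the product of discrete topologies,
    L countable) *)
Definition seqSpace (L : pointedType) := g_sigma_algebraType (@cylinders L).

Definition shift_invariant (R : realType) (L : pointedType)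
  (mu : probability (seqSpace L) R) : Prop :=
  forall A : set (seqSpace L), measurable A -> mu (@shift L @^-1` A) = mu A.

Definition block_count (L : eqType) (x : nat -> L) (B : seq L) (n : nat) : nat :=
  (\sum_(i < n) (mkseq (fun k => x (i + k)%N) (size B) == B))%N.

Definition block_freq (R : realType) (L : eqType) (x : nat -> L) (B : seq L)
  (n : nat) : R := (block_count x B n)%:R / n%:R.

Definition generic (R : realType) (L : pointedType)
  (mu : probability (seqSpace L) R) (x : nat -> L) : Prop :=
  forall B : seq L, @block_freq R L x B n @[n --> \oo] --> fine (mu (cyl B)).

(* nu is quasi-generated by y: nu is a weak-* accumulation point of the
   empirical measures of y, i.e. along some increasing sequence n_k
   all block frequencies converge to the nu-measures of the cylinders *)
Definition quasi_generated (R : realType) (L : pointedType)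
  (y : nat -> L) (nu : probability (seqSpace L) R) : Prop :=
  exists nk : nat -> nat, {homo nk : a b / (a < b)%N} /\
    forall B : seq L, @block_freq R L y B (nk k) @[k --> \oo] --> fine (nu (cyl B)).

Definition superficial (R : realType) (S : nat -> bool) : Prop :=
  forall nu : probability (seqSpace bool) R,
    shift_invariant nu -> quasi_generated S nu ->
    exists t : R, 0 <= t <= 1 /\
      forall A : set (seqSpace bool), measurable A ->
        nu A = (t%:E * @dirac _ (seqSpace bool) (fun _ : nat => false) R A
                + (1 - t)%:E * @dirac _ (seqSpace bool) (fun _ : nat => true) R A)%E.

(* Main.v *)
Require Import Defs.
From mathcomp Require Import all_boot all_order all_algebra.
From mathcomp Require Import all_classical all_reals all_analysis.
From mathcomp Require Import zify ring lra.
Import Order.TTheory GRing.Theory Num.Theory numFieldNormedType.Exports.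
Local Open Scope classical_set_scope.
Local Open Scope ring_scope.

(** A superficial [S] changes value only [o(n)] times below [n]: otherwise, along
    an ultrafilter refining the set of bad times, the block frequencies of [S]
    converge to the cylinder values of a shift-invariant measure which charges
    [01] or [10].  Hence, given any generic point [z], the point [x] obtained by
    writing a copy of [z] along [S] and another one along the complement of [S] is
    generic: away from the [o(n)] changes, a window of [x] is a window of one of
    the two copies.

    A generic point exists although [mu] need not be ergodic: concatenate words of
    lengths 1, 2, 3, ..., chosen greedily so that a weighted sum of the squared
    block discrepancies grows like [j ^ 3], while the total length after [j] words
    is of order [j ^ 2].  The choice is possible because, by invariance, the
    discrepancies of a [mu]-random word have mean zero. *)

Set Implicit Arguments. Unset Strict Implicit. Unset Printing Implicit Defensive.

(** * Averaging and enumeration *)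

(** The sum has integral zero; were it positive everywhere, its absolute value would integrate to
    zero too, forcing it to vanish almost everywhere. *)
Lemma exists_weighted_indic_le_mean (R : realType) d (T : measurableType d)
  (P : probability T R) (I : finType) (A : I -> set T) (a : I -> R) :
  (forall i, measurable (A i)) ->
  exists x, \sum_i a i * (\1_(A i) x - fine (P (A i))) <= 0.
Proof.
move=> mA; apply: contrapT => /forallNP h.
pose f x : R := \sum_i a i * (\1_(A i) x - fine (P (A i))).
have fgt0 x : 0 < f x by rewrite ltNge; exact/negP/h.
have intg i : P.-integrable setT
    (fun x => (a i)%:E * ((\1_(A i) x)%:E - (fine (P (A i)))%:E))%E.
  apply: integrableZl => //; apply: integrableB => //.
    exact: integrable_indic.
  exact: finite_measure_integrable_cst.
have fE x : ((f x)%:E = \sum_i (a i)%:E * ((\1_(A i) x)%:E - (fine (P (A i)))%:E))%E.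
  by rewrite /f -sumEFin.
have intf : P.-integrable setT (EFin \o f).
  have -> : EFin \o f = (fun x => \sum_i
      (a i)%:E * ((\1_(A i) x)%:E - (fine (P (A i)))%:E))%E by apply/funext.
  exact: integrable_sum.
have int0 : (\int[P]_x (f x)%:E = 0)%E.
  under eq_integral do rewrite fE.
  rewrite integral_sum// big1// => i _.
  rewrite integralZl//; last first.
    apply: integrableB => //; [exact: integrable_indic|exact: finite_measure_integrable_cst].
  rewrite integralB//; [|exact: integrable_indic|exact: finite_measure_integrable_cst].
  rewrite integral_indic// setIT integral_cst//.
  rewrite [X in (_ * (_ - _ * X))%E]probability_setT mule1.
  by rewrite fineK ?subee ?mule0 ?fin_num_measure.
have /(ae_eq_integral_abs P measurableT (measurable_int P intf)) :
    (\int[P]_(x in setT) `|(EFin \o f) x| = 0)%E.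
  rewrite -int0; apply: eq_integral => x _ /=.
  by rewrite ger0_norm// ltW.
case=> N [mN N0 sN].
suff NT : N = setT.
  by move: N0; rewrite NT [X in X = _]probability_setT => /eqP; rewrite onee_eq0.
apply/seteqP; split => // x _; apply: sN => /= /(_ Logic.I) [] /eqP.
by rewrite gt_eqF.
Qed.

Lemma fine_probability_itv (R : realType) d (T : measurableType d)
  (P : probability T R) (A : set T) : measurable A -> 0 <= fine (P A) <= 1.
Proof.
move=> mA; rewrite fine_ge0//= -lee_fin fineK ?fin_num_measure//.
exact: probability_le1.
Qed.

Lemma seq_enumeration (L : choiceType) : countable [set: L] ->
  exists b : nat -> seq L, forall B, exists k, b k = B.
Proof.
move=> /countable_injP[f finj].
pose g (B : seq L) := pickle [seq f x | x <- B].
have ginj : injective g.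
  by move=> B C /(pcan_inj pickleK); apply: inj_map => x y; apply: finj; rewrite in_setT.
exists (fun k => if pselect (exists B, g B = k) is left h then projT1 (cid h) else [::]).
move=> B; exists (g B); case: pselect => [h|[]]; last by exists B.
by case: cid => C /= /ginj.
Qed.

(** * Occurrences of blocks and their measure *)

Definition occurs (L : eqType) (x : nat -> L) (B : seq L) (i : nat) : bool :=
  mkseq (fun k => x (i + k)%N) (size B) == B.

Lemma block_countE (L : eqType) (x : nat -> L) B n :
  block_count x B n = (\sum_(i < n) occurs x B i)%N.
Proof. by []. Qed.

Lemma cyl_measurable (L : pointedType) (B : seq L) :
  measurable (cyl B : set (seqSpace L)).
Proof. by apply: sub_sigma_algebra; exists B. Qed.

(** [A] is the union of the cylinders of the length-[n] prefixes of its points, and there are only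
    countably many such words. *)
Lemma finite_window_measurable (L : pointedType) n (A : set (seqSpace L)) :
  countable [set: L] ->
  (forall x y : nat -> L, mkseq x n = mkseq y n -> A x -> A y) -> measurable A.
Proof.
move=> /seq_enumeration[b bP] hA.
have -> : A = \bigcup_(k in [set k | exists2 x, A x & mkseq x n = b k]) cyl (b k).
  apply/seteqP; split => [x Ax|x [k [y Ay yk]]].
    have [k kE] := bP (mkseq x n).
    by exists k; [exists x|rewrite /cyl /= kE size_mkseq].
  rewrite /cyl /= -yk size_mkseq => xy; exact: hA Ay.
by apply: bigcup_measurable => k _; exact: cyl_measurable.
Qed.

Lemma occurs_measurable (L : pointedType) B i : countable [set: L] ->
  measurable ([set x | occurs x B i] : set (seqSpace L)).
Proof.
move=> hL; apply: (@finite_window_measurable _ (i + size B)%N) => // x y xy /=.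
suff -> : occurs x B i = occurs y B i by [].
congr (_ == _); apply/eq_in_map => k; rewrite mem_iota => /andP[_ kB].
have := congr1 (nth point ^~ (i + k)%N) xy.
by rewrite !nth_mkseq//; lia.
Qed.

Lemma measure_occurs (R : realType) (L : pointedType)
  (mu : probability (seqSpace L) R) B i : countable [set: L] ->
  shift_invariant mu -> mu [set x | occurs x B i] = mu (cyl B).
Proof.
move=> hL hmu; elim: i => [|i IH].
  congr (mu _); apply/seteqP; split => x /=; first by move/eqP.
  by move=> xB; apply/eqP.
rewrite -IH -[RHS]hmu; last exact: occurs_measurable.
(* Occurrence at [i.+1] is, by conversion, occurrence at [i] in the shifted sequence. *)
by congr (mu _).
Qed.

(** Supplies the greedy step: invariance gives every occurrence the mean [mu (cyl (b m))], so
    averaging applies to the family indexed by pairs [(m, i)]. *)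
Lemma exists_weighted_occurs_le_mean (R : realType) (L : pointedType)
  (mu : probability (seqSpace L) R) (K N : nat) (a : nat -> R) (b : nat -> seq L) :
  countable [set: L] -> shift_invariant mu ->
  exists x : nat -> L, \sum_(m < K) a m *
    (\sum_(i < N) ((occurs x (b m) i)%:R - fine (mu (cyl (b m))))) <= 0.
Proof.
move=> hL hmu.
have [x xP] := @exists_weighted_indic_le_mean R _ _ mu ('I_K * 'I_N)%type
  (fun p => [set x | occurs x (b p.1) p.2]) (fun p => a p.1)
  (fun p => occurs_measurable (b p.1) p.2 hL).
exists x; apply: le_trans xP; rewrite le_eqVlt; apply/orP; left; apply/eqP.
rewrite -(pair_bigA _ (fun (m : 'I_K) (i : 'I_N) => a m *
  (\1_[set x | occurs x (b m) i] x - fine (mu [set x | occurs x (b m) i])))) /=.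
apply: eq_bigr => m _; rewrite mulr_sumr; apply: eq_bigr => i _.
rewrite measure_occurs// indicE; congr (_ * ((nat_of_bool _)%:R - _)).
by rewrite mem_setE.
Qed.

(** * Sublinear growth and block discrepancies *)

(** This form of [o(n)] bounds all [n] at once, 0 included, and so passes directly to sums and to
    compositions with [c n <= n]. *)
Definition sublinear (R : realType) (f : nat -> R) : Prop :=
  forall e : R, 0 < e -> exists C : R, forall n, `|f n| <= e * n%:R + C.

Lemma sublinearP (R : realType) (f : nat -> R) :
  sublinear f <-> f n / n%:R @[n --> \oo] --> (0 : R).
Proof.
split=> [sf|/cvgrPdist_le cf e e0].
  have h (e : R) : 0 < e -> \forall n \near \oo, `|f n / n%:R| <= e.
    move=> e0; have e20 : 0 < e / 2 by rewrite divr_gt0.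
    have [C CP] := sf _ e20.
    near=> n; have n0 : 0 < n%:R :> R by rewrite ltr0n; near: n; exact: nbhs_infty_gt.
    rewrite normrM normfV (ger0_norm (ltW n0)) ler_pdivrMr//.
    apply: le_trans (CP n) _.
    suff : C <= e / 2 * n%:R by lra.
    by rewrite -ler_pdivrMl//; near: n; exact: nbhs_infty_ger.
  apply/cvgrPdist_le => e e0; near=> n.
  by rewrite sub0r normrN; near: n; exact: h.
have [N _ NP] := cf e e0.
pose C := \sum_(i < N.+1) `|f i|; exists C => n.
have C0 : 0 <= C by apply: sumr_ge0.
have [nN|Nn] := ltnP n N.+1.
  apply: ler_wpDl; first by rewrite mulr_ge0// ltW.
  by rewrite /C (bigD1 (Ordinal nN))//= lerDl sumr_ge0.
apply: ler_wpDr => //; have := NP n (ltnW Nn).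
by rewrite /= sub0r normrN normrM normfV normr_nat ler_pdivrMr// ltr0n; lia.
Unshelve. all: by end_near. Qed.

Lemma sublinear_le (R : realType) (f g : nat -> R) :
  (forall n, `|f n| <= `|g n|) -> sublinear g -> sublinear f.
Proof.
move=> fg sg e e0; have [C CP] := sg e e0; exists C => n.
exact: le_trans (fg n) (CP n).
Qed.

Lemma sublinearD (R : realType) (f g : nat -> R) :
  sublinear f -> sublinear g -> sublinear (f \+ g).
Proof.
move=> sf sg e e0; have e20 : 0 < e / 2 by rewrite divr_gt0.
have [C CP] := sf _ e20; have [D DP] := sg _ e20.
exists (C + D) => n; apply: le_trans (ler_normD _ _) _.
by have := CP n; have := DP n; lra.
Qed.

Lemma sublinearZ (R : realType) (c : R) (f : nat -> R) :
  sublinear f -> sublinear (fun n => c * f n).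
Proof.
move=> /sublinearP sf; apply/sublinearP; rewrite -(mulr0 c).
by under eq_fun do rewrite -mulrA; exact: cvgMl_tmp.
Qed.

Definition discrepancy (R : realType) (L : eqType) (p : R) (x : nat -> L) (B : seq L)
  (n : nat) : R := \sum_(i < n) ((occurs x B i)%:R - p).

Lemma discrepancyE (R : realType) (L : eqType) (p : R) (x : nat -> L) B n :
  discrepancy p x B n = (block_count x B n)%:R - p * n%:R.
Proof.
rewrite /discrepancy sumrB block_countE natr_sum sumr_const card_ord.
by rewrite mulr_natr.
Qed.

Lemma generic_sublinear (R : realType) (L : pointedType)
    (mu : probability (seqSpace L) R) (x : nat -> L) :
  generic mu x <-> forall B, sublinear (discrepancy (fine (mu (cyl B))) x B).
Proof.
suff H B : @block_freq R L x B n @[n --> \oo] --> fine (mu (cyl B)) <->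
           sublinear (discrepancy (fine (mu (cyl B))) x B).
  by split=> h B; apply/H.
rewrite sublinearP; set p := fine _.
(* At [n = 0] both quotients are 0 by convention and the identity would read [0 = - p]. *)
have E : \forall n \near \oo, discrepancy p x B n / n%:R = block_freq R x B n - p.
  near=> n; rewrite discrepancyE /block_freq mulrBl mulfK// pnatr_eq0 -lt0n.
  by near: n; exact: nbhs_infty_gt.
rewrite -subr_cvg0; split=> h; apply: cvg_trans h; apply: near_eq_cvg => //.
by near=> n; apply/esym; exact: (near E n).
Unshelve. all: by end_near. Qed.

Lemma discrepancy_le (R : realType) (L : eqType) (p : R) (x : nat -> L) B n :
  0 <= p <= 1 -> `|discrepancy p x B n| <= n%:R.
Proof.
move=> p01; apply: le_trans (ler_norm_sum _ _ _) _.
rewrite -[n in leRHS]card_ord -sumr_const ler_sum// => i _.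
by rewrite ler_norml; case: (occurs _ _ _) => /=; lra.
Qed.

(** * Greedy control of countably many sums *)

(* The greedy choice makes the cross term of the weighted sum of squares
   nonpositive at every step, so that only the sum of the [D m i (X i) ^+ 2] is
   left; the [m]-th family is taken into account from time [m] on. *)
Lemma greedy_sum_bound (R : realType) (T : Type) (D : nat -> nat -> T -> R) (N : nat -> R) :
  (forall m i x, `|D m i x| <= N i) ->
  (forall i (a : nat -> R), exists x, \sum_(m < i.+1) a m * D m i x <= 0) ->
  exists X : nat -> T, forall m J,
    (\sum_(m <= i < J) D m i (X i)) ^+ 2 <= 2 ^+ m.+1 * \sum_(i < J) N i ^+ 2.
Proof.
(* These weights sum to less than 1, so step [i] adds at most [N i ^+ 2] to the weighted energy;
   undoing them costs the factor [2 ^+ m.+1]. *)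
move=> DN Dle0; pose w m : R := 2^-1 ^+ m.+1.
have w0 m : 0 < w m by rewrite exprn_gt0// invr_gt0.
have sw n : \sum_(m < n) w m = 1 - 2^-1 ^+ n.
  elim: n => [|n IH]; first by rewrite big_ord0 expr0 subrr.
  by rewrite big_ord_recr/= IH /w exprS; lra.
(* The coefficients [w m * E m] are those of the cross term in the expanded squares. *)
have [pick pickP] : exists pick : nat -> (nat -> R) -> T,
    forall i (E : nat -> R), \sum_(m < i.+1) (w m * E m) * D m i (pick i E) <= 0.
  exists (fun i E => projT1 (cid (Dle0 i (fun m => w m * E m)))) => i E.
  exact: (projT2 (cid (Dle0 i (fun m => w m * E m)))).
(* [E j m] is the running sum of family [m] before time [j]; the choice at time [j] depends on all
   of these, hence the joint recursion. *)
have [E [E00 ES]] : exists E : nat -> nat -> R, (forall m, E 0%N m = 0) /\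
    forall j m, E j.+1 m = E j m + (if (m <= j)%N then D m j (pick j (E j)) else 0).
  pose F := fix F i := if i is j.+1 then fun m =>
    F j m + (if (m <= j)%N then D m j (pick j (F j)) else 0) else fun=> 0.
  by exists F.
have E0 j m : (j <= m)%N -> E j m = 0.
  elim: j => [|j IH] jm; first exact: E00.
  by rewrite ES (IH (ltnW jm)) add0r leqNgt jm.
pose X j := pick j (E j); exists X.
have EE m J : \sum_(m <= i < J) D m i (X i) = E J m.
  elim: J => [|J IH]; first by rewrite big_geq.
  have [Jm|mJ] := ltnP J m; first by rewrite big_geq// E0.
  by rewrite big_nat_recr//= IH ES mJ.
have Phi J : \sum_(m < J) w m * E J m ^+ 2 <= \sum_(i < J) N i ^+ 2.
  elim: J => [|J IH]; first by rewrite !big_ord0.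
  rewrite [leRHS]big_ord_recr/=.
  have -> : \sum_(m < J.+1) w m * E J.+1 m ^+ 2 =
    \sum_(m < J) w m * E J m ^+ 2
    + 2 * \sum_(m < J.+1) w m * E J m * D m J (pick J (E J))
    + \sum_(m < J.+1) w m * D m J (pick J (E J)) ^+ 2.
    (* Family [J] starts only at time [J], so [E J J] is still 0. *)
    have -> : \sum_(m < J) w m * E J m ^+ 2 = \sum_(m < J.+1) w m * E J m ^+ 2.
      by rewrite [RHS]big_ord_recr/= (E0 J J)// expr0n/= mulr0 addr0.
    rewrite mulr_sumr -!big_split/=; apply: eq_bigr => m _.
    by rewrite ES -ltnS ltn_ord; ring.
  have cross := pickP J (E J).
  suff : \sum_(m < J.+1) w m * D m J (pick J (E J)) ^+ 2 <= N J ^+ 2 by lra.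
  apply: (@le_trans _ _ (\sum_(m < J.+1) w m * N J ^+ 2)).
    apply: ler_sum => m _; rewrite ler_pM2l// -real_normK ?num_real//.
    rewrite ler_pXn2r// ?nnegrE//; exact: le_trans (DN m J (pick J (E J))).
  rewrite -mulr_suml sw; apply: ler_piMl; first exact: sqr_ge0.
  by rewrite lerBlDr lerDl exprn_ge0// invr_ge0.
move=> m J; rewrite EE.
have sN0 : 0 <= \sum_(i < J) N i ^+ 2 by apply: sumr_ge0 => i _; exact: sqr_ge0.
have [mJ|Jm] := ltnP m J; last first.
  by rewrite E0// expr0n/= mulr_ge0// exprn_ge0.
rewrite -ler_pdivrMl ?exprn_gt0//.
apply: le_trans (Phi J); rewrite -exprVn -/(w m).
rewrite (bigD1 (Ordinal mJ))//= lerDl sumr_ge0// => i _.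
by rewrite mulr_ge0 ?sqr_ge0// ltW.
Qed.

(** * Concatenation of words of increasing lengths *)

(** The position at which word [J] starts, word [j] having length [j.+1]. *)
Definition triangle (J : nat) : nat := (\sum_(j < J) j.+1)%N.

Lemma triangleS J : triangle J.+1 = (triangle J + J.+1)%N.
Proof. by rewrite /triangle big_ord_recr. Qed.

Lemma double_triangle J : (triangle J * 2 = J * J.+1)%N.
Proof. by elim: J => [|J IH]; [rewrite /triangle big_ord0|rewrite triangleS; nia]. Qed.

Lemma leq_triangle J J' : (J <= J')%N -> (triangle J <= triangle J')%N.
Proof. by move=> JJ'; have := double_triangle J; have := double_triangle J'; nia. Qed.

Lemma triangle_decomposition n : exists j i, (i <= j)%N /\ n = (triangle j + i)%N.
Proof.
elim: n => [|n [j [i [ij ->]]]]; first by exists 0%N, 0%N; rewrite /triangle big_ord0.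
have [ltij|] := ltnP i j; first by exists j, i.+1; rewrite addnS.
by move=> ji; exists j.+1, 0%N; rewrite triangleS; split => //; lia.
Qed.

(** Inverts [triangle j + i] on pairs with [i <= j], by walking through these pairs in order. *)
Definition triangle_pos (n : nat) : nat * nat :=
  iter n (fun p => if (p.2 < p.1)%N then (p.1, p.2.+1) else (p.1.+1, 0%N)) (0%N, 0%N).

Lemma triangle_posE j i : (i <= j)%N -> triangle_pos (triangle j + i) = (j, i).
Proof.
elim: j i => [|j IH] i; first by rewrite leqn0 => /eqP->; rewrite /triangle big_ord0.
elim: i => [_|i IHi ij].
  by rewrite triangleS addn0 addnS /triangle_pos iterS -/(triangle_pos _) IH//= ltnn.
by rewrite addnS /triangle_pos iterS -/(triangle_pos _) IHi ?(ltnW ij)//= ij.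
Qed.

Lemma sum_triangle (V : nmodType) (f : nat -> V) J :
  \sum_(n < triangle J) f n = \sum_(j < J) \sum_(i < j.+1) f (triangle j + i)%N.
Proof.
elim: J => [|J IH]; first by rewrite /triangle !big_ord0.
by rewrite triangleS big_split_ord/= IH [RHS]big_ord_recr.
Qed.

Lemma sum_leq_index k n : (\sum_(i < n) (k <= i) = n - k)%N.
Proof.
elim: n => [|n IH]; first by rewrite big_ord0.
by rewrite big_ord_recr/= IH; case: leqP; lia.
Qed.

Lemma discrepancy_diff_le (R : realType) (L : eqType) (p : R) (x y : nat -> L) B n k :
  (forall i, (i < n)%N -> (i < k)%N -> occurs x B i = occurs y B i) ->
  `|discrepancy p x B n - discrepancy p y B n| <= (n - k)%:R.
Proof.
move=> xy; rewrite /discrepancy -sumrB -sum_leq_index natr_sum.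
apply: le_trans (ler_norm_sum _ _ _) _; apply: ler_sum => i _.
rewrite opprB addrA subrK; have [ki|ik] := leqP k i.
  by rewrite ler_norml; case: occurs; case: occurs; rewrite /=; lra.
by rewrite xy// subrr normr0.
Qed.

Definition concat (L : Type) (X : nat -> nat -> L) (n : nat) : L :=
  X (triangle_pos n).1 (triangle_pos n).2.

Lemma occurs_concat (L : eqType) (X : nat -> nat -> L) B j i :
  (i + size B <= j.+1)%N -> (i <= j)%N ->
  occurs (concat X) B (triangle j + i) = occurs (X j) B i.
Proof.
move=> iB ij; congr (_ == _); apply/eq_in_map => k; rewrite mem_iota => /andP[_ kB].
by rewrite /concat -addnA triangle_posE//; lia.
Qed.

(** Only windows running past the end of their word can differ from those of [X j], at most [size B]
    of them per word. *)
Lemma discrepancy_concat_triangle (R : realType) (L : eqType) (p : R) X (B : seq L) J :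
  `|discrepancy p (concat X) B (triangle J) - \sum_(j < J) discrepancy p (X j) B j.+1|
    <= (J * size B)%:R.
Proof.
rewrite /discrepancy (sum_triangle (fun n => (occurs (concat X) B n)%:R - p)).
rewrite -sumrB; apply: le_trans (ler_norm_sum _ _ _) _.
rewrite -[J in leRHS]card_ord -sum_nat_const natr_sum; apply: ler_sum => j _.
pose y n := concat X (triangle j + n).
have yE i : occurs (concat X) B (triangle j + i) = occurs y B i.
  by congr (_ == _); apply: eq_map => k; rewrite /y addnA.
under eq_bigr do rewrite yE.
(* Windows starting before [j.+2 - size B] fit inside a word of length [j.+1]. *)
apply: (@le_trans _ _ (j.+1 - (j.+2 - size B))%:R); last by rewrite ler_nat; lia.
apply: (discrepancy_diff_le p (y := X j)) => i ij iB.
by rewrite -yE occurs_concat//; lia.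
Qed.

Lemma discrepancyD_le (R : realType) (L : eqType) (p : R) (x : nat -> L) B n k :
  0 <= p <= 1 -> `|discrepancy p x B (n + k)| <= `|discrepancy p x B n| + k%:R.
Proof.
move=> p01; rewrite /discrepancy big_split_ord/=.
apply: le_trans (ler_normD _ _) _; rewrite lerD2l.
apply: le_trans (ler_norm_sum _ _ _) _.
rewrite -[k in leRHS]card_ord -sumr_const ler_sum// => i _.
by rewrite ler_norml; case: (occurs _ _ _) => /=; lra.
Qed.

(** * Growth estimates and a generic point *)

Lemma sum_sqr_le (R : realType) J : \sum_(i < J) i.+1%:R ^+ 2 <= J%:R ^+ 3 :> R.
Proof.
rewrite exprS -[J in leRHS]card_ord mulr_natl -sumr_const.
by apply: ler_sum => i _; rewrite card_ord ler_pXn2r ?nnegrE// ler_nat.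
Qed.

Lemma linear_quadratic_bound (R : realType) (c e : R) : 0 <= c -> 0 < e ->
  exists C, forall J, 0 <= J -> c * J <= e * J ^+ 2 + C.
Proof.
(* The constant comes from [(e * J - c) ^+ 2 >= 0]. *)
move=> c0 e0; exists (c ^+ 2 / e) => J J0.
rewrite -(ler_pM2l e0) mulrDr [e * (c ^+ 2 / e)]mulrC divfK ?gt_eqF//.
have := sqr_ge0 (e * J - c); have := mulr_ge0 (mulr_ge0 (ltW e0) c0) J0; nra.
Qed.

Lemma cubic_quadratic_bound (R : realType) (c e : R) : 0 <= c -> 0 < e ->
  exists C, forall J x, 0 <= J -> x ^+ 2 <= c * J ^+ 3 -> `|x| <= e * J ^+ 2 + C.
Proof.
move=> c0 e0; have [C CP] := linear_quadratic_bound c0 (exprn_gt0 2 e0).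
have C0 : 0 <= C by have := CP 0 (lexx 0); rewrite mulr0 expr0n/= mulr0 add0r.
(* With [D = C / e / 2], the cross term of [(e * J ^+ 2 + D) ^+ 2] is exactly [C * J ^+ 2]. *)
exists (C / e / 2) => J x J0 xJ.
have eD : e * (C / e / 2) = C / 2 by field; rewrite gt_eqF.
have D0 : 0 <= C / e / 2 by rewrite !divr_ge0// ltW.
move: (C / e / 2) eD D0 => D eD D0.
rewrite -[leRHS]ger0_norm; last first.
  by rewrite addr_ge0// mulr_ge0 ?sqr_ge0// ltW.
rewrite -ler_sqr ?nnegrE ?normr_ge0// !real_normK ?num_real//.
apply: le_trans xJ _; have := ler_wpM2r (sqr_ge0 J) (CP J J0).
have -> : (e * J ^+ 2 + D) ^+ 2 = e ^+ 2 * J ^+ 4 + 2 * (e * D) * J ^+ 2 + D ^+ 2 by ring.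
rewrite eD => h; apply: (@le_trans _ _ ((e ^+ 2 * J ^+ 2 + C) * J ^+ 2)).
  by apply: le_trans h; rewrite le_eqVlt; apply/orP; left; apply/eqP; ring.
by have := sqr_ge0 D; nra.
Qed.

Theorem exists_generic (R : realType) (L : pointedType)
  (mu : probability (seqSpace L) R) :
  countable [set: L] -> shift_invariant mu -> exists z, generic mu z.
Proof.
move=> hL hmu; have [b bP] := seq_enumeration hL.
pose p m := fine (mu (cyl (b m))).
have p01 m : 0 <= p m <= 1 by apply: fine_probability_itv; exact: cyl_measurable.
have [X XP] := @greedy_sum_bound R (nat -> L)
  (fun m j x => discrepancy (p m) x (b m) j.+1) (fun j => j.+1%:R)
  (fun m j x => discrepancy_le x (b m) j.+1 (p01 m))
  (fun j a => exists_weighted_occurs_le_mean j.+1 j.+1 a b hL hmu).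
exists (concat X); apply/generic_sublinear => B.
have [m <-] := bP B; rewrite -/(p m) => e e0.
(* Two error terms each take [e / 4 * j ^+ 2], and [j ^+ 2 <= 2 * triangle j] bounds their sum by
   [e * triangle j]. *)
have e40 : 0 < e / 4 by rewrite divr_gt0.
(* [size (b m)] accounts for the straddling windows of each word, the extra 1 for the [i <= j]
   letters of the unfinished word. *)
have [C1 C1P] := linear_quadratic_bound (ler0n R (size (b m)).+1) e40.
have [C2 C2P] := cubic_quadratic_bound (exprn_ge0 m.+1 (ler0n R 2)) e40.
exists (C1 + C2 + (triangle m)%:R) => n.
have [j [i [ij ->]]] := triangle_decomposition n.
apply: le_trans (discrepancyD_le _ _ _ _ (p01 m)) _.
have d1 := discrepancy_concat_triangle (p m) X (b m) j.
pose d k := discrepancy (p m) (X k) (b m) k.+1.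
(* Words before time [m] are not controlled for the block [b m]; they contribute at most their total
   length. *)
have d2 : `|\sum_(k < j) d k| <= `|\sum_(m <= k < j) d k| + (triangle m)%:R.
  have dT J : `|\sum_(k < J) d k| <= (triangle J)%:R.
    apply: le_trans (ler_norm_sum _ _ _) _; rewrite natr_sum.
    by apply: ler_sum => k _; exact: discrepancy_le.
  have [mj|jm] := leqP m j; last first.
    apply: le_trans (dT j) _; apply: ler_wpDl => //.
    by rewrite ler_nat leq_triangle// ltnW.
  rewrite -(big_mkord xpredT) (big_cat_nat (leq0n m) mj)/= big_mkord.
  apply: le_trans (ler_normD _ _) _.
  by rewrite addrC lerD2l.
have j0 : 0 <= j%:R :> R by [].
have d3 : `|\sum_(m <= k < j) d k| <= e / 4 * j%:R ^+ 2 + C2.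
  apply: C2P => //; apply: le_trans (XP m j) _.
  by rewrite ler_wpM2l ?exprn_ge0// sum_sqr_le.
have d4 := C1P _ j0.
have d5 : i%:R <= j%:R :> R by rewrite ler_nat.
have d6 : j%:R ^+ 2 <= 2 * (triangle j)%:R :> R.
  by rewrite -natrX -natrM ler_nat; have := double_triangle j; nia.
have d7 : `|discrepancy (p m) (concat X) (b m) (triangle j)| <=
    (j * size (b m))%:R + `|\sum_(k < j) d k|.
  by rewrite -lerBlDr; apply: le_trans (lerB_dist _ _) d1.
have d8 : e / 2 * j%:R ^+ 2 <= e * (triangle j)%:R.
  by have := ler_wpM2l (ltW e40) d6; lra.
have d9 : e * (triangle j)%:R <= e * (triangle j + i)%:R.
  by apply: ler_wpM2l; rewrite ?(ltW e0)// ler_nat leq_addr.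
move: d4 d7; rewrite natrM -(addn1 (size _)) natrD mulrDl mul1r [j%:R * _]mulrC.
lra.
Qed.

(** * Copying a generic point along [S] and its complement *)

Lemma sublinear_comp (R : realType) (f : nat -> R) (c : nat -> nat) :
  (forall n, (c n <= n)%N) -> sublinear f -> sublinear (f \o c).
Proof.
move=> cn sf e e0; have [C CP] := sf e e0; exists C => n.
apply: le_trans (CP (c n)) _; rewrite lerD2r ler_wpM2l ?ler_nat//.
exact: ltW.
Qed.

Lemma sublinear_cst (R : realType) (c : R) : sublinear (fun=> c).
Proof. by move=> e e0; exists `|c| => n; rewrite lerDr mulr_ge0// ltW. Qed.

Definition changes (S : nat -> bool) (n : nat) : nat := (\sum_(i < n) (S i != S i.+1))%N.

(** The rank of [i] on its own side, [S] or the complement; both sides are counted from 0, so each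
    receives its own copy of [z]. *)
Definition class_rank (S : nat -> bool) (i : nat) : nat := (\sum_(j < i) (S j == S i))%N.

Lemma changesD_le S k n : (\sum_(i < n) (S (i + k) != S (i + k).+1) <= changes S n + k)%N.
Proof.
apply: (@leq_trans (changes S (k + n))).
  rewrite /changes big_split_ord/= -[leqLHS]add0n leq_add//.
  by apply: leq_sum => i _; rewrite addnC.
rewrite addnC /changes big_split_ord/= leq_add2l.
rewrite -[k in leqRHS]card_ord -sum1_card leq_sum// => i _.
exact: leq_b1.
Qed.

Lemma class_rank_enum (S : nat -> bool) (s : nat -> nat) k :
  {homo s : a b / (a < b)%N} -> (forall n, S n <-> exists k, s k = n) ->
  class_rank S (s k) = k.
Proof.
move=> sincr srange.
have Ssk l : S (s l) by apply/srange; exists l.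
have smono l m : (s l < s m)%N = (l < m)%N.
  apply/idP/idP => [|/sincr//]; rewrite !ltnNge; apply: contra.
  by rewrite leq_eqVlt => /orP[/eqP->//|/sincr/ltnW].
(* If [c] elements of [S] lie below [n], then [s l < n] exactly when [l < c]; at [n = s k] this
   forces [c = k]. *)
have H n : (n <= s (\sum_(j < n) S j)%N)%N /\
    forall l, (l < \sum_(j < n) S j)%N -> (s l < n)%N.
  elim: n => [|n [IH1 IH2]]; first by rewrite big_ord0.
  rewrite big_ord_recr/=; set c := (\sum_(i < n) S i)%N in IH1 IH2 *.
  have [Sn|Sn] := boolP (S n); last first.
    rewrite addn0; split => [|l /IH2 /ltnW]; last by rewrite ltnS.
    by rewrite ltn_neqAle IH1 andbT; apply: contra Sn => /eqP ->.
  have [l ln] := (srange n).1 Sn.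
  have lc : l = c.
    apply/eqP; rewrite eqn_leq; apply/andP; split; rewrite leqNgt.
      by rewrite -smono ln -leqNgt.
    by apply/negP => /IH2; rewrite ln ltnn.
  rewrite -lc -ln addn1 smono; split => // m; rewrite !ltnS => ml.
  by rewrite leqNgt smono -leqNgt.
rewrite /class_rank; under eq_bigr do rewrite Ssk eqb_id.
have [H1 H2] := H (s k); apply/eqP; rewrite eqn_leq; apply/andP; split.
  by rewrite leqNgt; apply/negP => /H2; rewrite ltnn.
by rewrite leqNgt -smono -leqNgt.
Qed.

(** Below [n], each side takes its ranks consecutively from 0, once each. *)
Lemma sum_class_rank (V : nmodType) (S : nat -> bool) (f : nat -> V) n :
  \sum_(i < n) f (class_rank S i) =
  \sum_(i < \sum_(j < n) S j) f i + \sum_(i < \sum_(j < n) ~~ S j) f i.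
Proof.
elim: n => [|n IH]; first by rewrite !big_ord0 addr0.
have recr (T : nat -> bool) : (\sum_(j < n.+1) T j = \sum_(j < n) T j + T n)%N.
  exact: big_ord_recr.
rewrite big_ord_recr/= IH (recr S) (recr (fun j => ~~ S j)) /class_rank.
case: (S n) => /=.
  rewrite addn0 addn1 big_ord_recr/= addrAC.
  by under [X in f X]eq_bigr do rewrite eqb_id.
rewrite addn0 addn1 [in RHS]big_ord_recr/= addrA.
by under [X in f X]eq_bigr do rewrite eqbF_neg.
Qed.

Lemma class_rankD (S : nat -> bool) i q :
  (forall k, (k < q)%N -> S (i + k)%N = S (i + k).+1) ->
  forall k, (k <= q)%N -> S (i + k)%N = S i /\ class_rank S (i + k) = (class_rank S i + k)%N.
Proof.
move=> Sq; elim=> [|k IH] kq; first by rewrite !addn0.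
have [S1 S2] := IH (ltnW kq).
rewrite addnS -(Sq k kq) S1; split => //.
rewrite addnS -S2 /class_rank big_ord_recr/= -(Sq k kq) eqxx addn1.
by [].
Qed.

Definition spread (L : Type) (S : nat -> bool) (z : nat -> L) (i : nat) : L :=
  z (class_rank S i).

(** Without a change of [S] in the window, the ranks advance by one and a window of [z] is read;
    otherwise the right side is at least 1. *)
Lemma occurs_spread (L : eqType) S (z : nat -> L) B i :
  ((occurs (spread S z) B i != occurs z B (class_rank S i)) <=
   \sum_(k < size B) (S (i + k) != S (i + k).+1))%N.
Proof.
have [/forallP h|] := boolP [forall k : 'I_(size B), S (i + k)%N == S (i + k).+1].
  suff -> : occurs (spread S z) B i = occurs z B (class_rank S i) by rewrite eqxx.
  congr (_ == _); apply/eq_in_map => k; rewrite mem_iota => /andP[_ kB].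
  rewrite /spread (class_rankD (q := size B) _ (ltnW kB)).2// => l lB.
  exact/eqP/(h (Ordinal lB)).
rewrite negb_forall => /existsP[k hk].
by rewrite (bigD1 k)//= hk; case: (_ != _).
Qed.

Lemma generic_spread (R : realType) (L : pointedType)
    (mu : probability (seqSpace L) R) (S : nat -> bool) (z : nat -> L) :
  sublinear (fun n => (changes S n)%:R : R) -> generic mu z -> generic mu (spread S z).
Proof.
move=> Sc /generic_sublinear gz; apply/generic_sublinear => B.
move: (gz B); set p := fine _ => zB; set x := spread S z.
pose c n := (\sum_(j < n) S j)%N; pose c' n := (\sum_(j < n) ~~ S j)%N.
have cn n : (c n <= n)%N.
  by rewrite -[leqRHS]card_ord -sum1_card leq_sum// => i _; exact: leq_b1.
have c'n n : (c' n <= n)%N.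
  by rewrite -[leqRHS]card_ord -sum1_card leq_sum// => i _; exact: leq_b1.
pose d n := discrepancy p x B n - (discrepancy p z B (c n) + discrepancy p z B (c' n)).
have -> : discrepancy p x B =
    d \+ ((discrepancy p z B \o c) \+ (discrepancy p z B \o c')).
  by apply/funext => n; rewrite /d /= subrK.
apply: sublinearD; last by apply: sublinearD; exact: sublinear_comp.
(* For each of the [size B] offsets, the shifted count of changes is at most
   [changes S n + size B]. *)
pose g n : R := (size B)%:R * (changes S n)%:R + (size B * size B)%:R.
apply: (@sublinear_le _ _ g); last exact: sublinearD (sublinearZ _ Sc) (sublinear_cst _).
move=> n; have g0 : 0 <= g n by rewrite addr_ge0// mulr_ge0.
rewrite (ger0_norm g0) /d /discrepancy.
rewrite -(sum_class_rank S (fun i => (occurs z B i)%:R - p)) -sumrB.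
apply: le_trans (ler_norm_sum _ _ _) _.
apply: (@le_trans _ _ (\sum_(i < n) (\sum_(k < size B) (S (i + k) != S (i + k).+1))%N)%:R).
  rewrite natr_sum; apply: ler_sum => i _.
  apply: (@le_trans _ _ (occurs x B i != occurs z B (class_rank S i))%:R); last first.
    by rewrite ler_nat occurs_spread.
  by rewrite opprB addrA subrK; case: occurs; case: occurs; rewrite ler_norml /=; lra.
rewrite /g -natrM -natrD ler_nat exchange_big/=.
rewrite -mulnDr -[X in (_ <= X * _)%N]card_ord -sum_nat_const.
apply: leq_sum => k _; apply: leq_trans (changesD_le _ _ _) _.
by rewrite leq_add2l ltnW.
Qed.

(** * Measures with prescribed cylinder values *)

Section Coding.
Variables (R : realType) (p : seq bool -> R).
Hypothesis p_ge0 : forall w, 0 <= p w.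
Hypothesis p_nil : p [::] = 1.
Hypothesis p_rcons : forall w, p w = p (rcons w false) + p (rcons w true).

(* The intervals [left_end w, left_end w + p w[ of words of a fixed length
   partition [0, 1[ in lexicographic order. *)
Let left_end (w : seq bool) : R :=
  \sum_(k < size w | nth false w k) p (rcons (take k w) false).

Let left_end_rcons w b :
  left_end (rcons w b) = left_end w + (if b then p (rcons w false) else 0).
Proof.
rewrite /left_end size_rcons big_mkcond big_ord_recr/= nth_rcons ltnn eqxx.
congr (_ + _); last by rewrite -(cats1 w) take_size_cat.
rewrite [RHS]big_mkcond/=; apply: eq_bigr => k _.
by rewrite nth_rcons ltn_ord -(cats1 w) takel_cat// ltnW.
Qed.

Let left_end_ge0_le1 w : 0 <= left_end w <= 1 - p w.
Proof.
elim/last_ind: w => [|w b IH]; first by rewrite /left_end big_ord0 p_nil subrr lexx.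
rewrite left_end_rcons; have := p_rcons w.
have := p_ge0 (rcons w false); have := p_ge0 (rcons w true).
case: b; lra.
Qed.

(** The interval of [w] is cut at [left_end w + p (rcons w false)] into those of its two extensions;
    the bit tells on which side of the cut [u] lies. *)
Let coded_bit (u : R) (w : seq bool) : bool := left_end w + p (rcons w false) <= u.

Let coded_prefix (u : R) (n : nat) : seq bool :=
  iter n (fun w => rcons w (coded_bit u w)) [::].

Let coding (u : R) (n : nat) : bool := coded_bit u (coded_prefix u n).

Let mkseq_coding u n : mkseq (coding u) n = coded_prefix u n.
Proof.
elim: n => // n IH; rewrite /mkseq -addn1 iotaD map_cat /= add0n.
by rewrite -/(mkseq _ _) IH addn1 /= cats1.
Qed.

Let coded_prefix_rcons u w b : (coded_prefix u (size w).+1 == rcons w b) =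
  (coded_prefix u (size w) == w) && (coded_bit u w == b).
Proof.
rewrite /= eqseq_rcons; case: eqP => //= ->.
by [].
Qed.

Let coded_prefix_itv u w : 0 <= u < 1 ->
  (coded_prefix u (size w) == w) = (left_end w <= u < left_end w + p w).
Proof.
move=> u01; elim/last_ind: w => [|w b IH].
  by rewrite /left_end big_ord0 p_nil add0r.
rewrite size_rcons coded_prefix_rcons IH left_end_rcons /coded_bit (p_rcons w).
have p0 := p_ge0 (rcons w false); have p1 := p_ge0 (rcons w true).
case: b; rewrite ?addr0 ?eqb_id ?eqbF_neg -?ltNge.
  by apply/andP/andP => [[/andP[h1 h2] h3]|[h1 h2]]; split => //; lra.
by apply/andP/andP => [[/andP[h1 h2] h3]|[h1 h2]]; split => //; lra.
Qed.

Let measurable_coding_cyl w :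
  measurable [set u : measurableTypeR R | coded_prefix u (size w) == w].
Proof.
elim/last_ind: w => [|w b IH].
  by rewrite (_ : [set _ | _] = setT)//; apply/seteqP; split.
have -> : [set u : measurableTypeR R | coded_prefix u (size (rcons w b)) == rcons w b]
  = [set u | coded_prefix u (size w) == w] `&` [set u | coded_bit u w == b].
  apply/seteqP; split => u /=; rewrite size_rcons coded_prefix_rcons.
    by move=> /andP.
  by move=> [-> ->].
apply: measurableI => //; rewrite /coded_bit; set c := left_end w + _.
case: b.
  rewrite (_ : [set _ | _] = `[c, +oo[%classic); first exact: measurable_itv.
  by apply/seteqP; split => u /=; rewrite in_itv/= andbT eqb_id.
rewrite (_ : [set _ | _] = `]-oo, c[%classic); first exact: measurable_itv.
by apply/seteqP; split => u /=; rewrite in_itv/= eqbF_neg -ltNge.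
Qed.

Let coding_preimage w : (coding : measurableTypeR R -> seqSpace bool) @^-1` cyl w =
  [set u | coded_prefix u (size w) == w].
Proof.
by apply/seteqP; split => u /=; rewrite /cyl /= mkseq_coding => /eqP.
Qed.

Let measurable_coding :
  measurable_fun setT (coding : measurableTypeR R -> seqSpace bool).
Proof.
apply: (@measurability _ _ (measurableTypeR R) (seqSpace bool) setT _ (@cylinders bool)) => //.
move=> _ [_ [w _ <-] <-].
by rewrite setTI coding_preimage.
Qed.

(** [nu] is the law of [coding u] for [u] uniform: for [u] in [[0, 1[], the prefix [w] is read
    exactly on an interval of length [p w]. *)
Lemma consistent_probability : exists nu : probability (seqSpace bool) R,
  forall w, nu (cyl w) = (p w)%:E.
Proof.
have mX : (coding : measurableTypeR R -> seqSpace bool) \in mfun.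
  by rewrite inE; exact: measurable_coding.
exists (distribution (uniform_prob (@ltr01 R)) (mfun_Sub mX)) => w.
rewrite /distribution /pushforward /=.
have -> : mfun_Sub mX @^-1` cyl w = [set u | coded_prefix u (size w) == w].
  exact: coding_preimage.
(* The half-open intervals partition [[0, 1[], whereas the uniform density lives on [[0, 1]]; the
   null point 1 is discarded. *)
rewrite /uniform_prob -(@integral_setD1 _ _ 1); last 2 first.
  - by apply: measurableD => //; exact: measurable_coding_cyl.
  - apply: (@measurable_funS _ _ _ _ setT) => //.
    exact: (measurable_int _ (integrable_uniform_pdf ltr01)).
rewrite integral_uniform_pdf.
have -> : ([set u | coded_prefix u (size w) == w] `\ 1) `&` `[0, 1] =
    `[left_end w, left_end w + p w[%classic.
  have /andP[l0 l1] := left_end_ge0_le1 w.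
  apply/seteqP; split => u /=; rewrite !in_itv/=.
    move=> [[uw u1] /andP[u0 u1']]; rewrite -coded_prefix_itv// u0/=.
    by rewrite lt_neqAle u1' andbT; exact/eqP.
  move=> uw; have u01 : 0 <= u < 1 by lra.
  split; last by lra.
  split; first by rewrite coded_prefix_itv.
  by move=> u1; move: u01; rewrite u1 ltxx andbF.
rewrite (eq_integral (cst 1%:E)); last first.
  move=> u; rewrite inE/= in_itv/= => ulr; rewrite /uniform_pdf subr0 invr1 ifT//.
  by have := left_end_ge0_le1 w; lra.
rewrite integral_cst//= mul1e lebesgue_measure_itv/= lte_fin ltrDl.
have := p_ge0 w; rewrite le_eqVlt => /orP[/eqP <-|->]; first by rewrite ltxx.
by rewrite -EFinB addrC addKr.
Qed.

End Coding.

(** * Equality and shift invariance of measures, tested on cylinders *)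

(** Two cylinders are nested or disjoint. *)
Lemma cylinders0_setI_closed (L : eqType) :
  setI_closed (@cylinders L `|` [set set0]).
Proof.
suff H (B C : seq L) : (size B <= size C)%N ->
    (@cylinders L `|` [set set0]) (cyl B `&` cyl C).
  move=> _ _ [[B _ <-]|->] [[C _ <-]|->]; rewrite ?set0I ?setI0; try by right.
  by case/orP: (leq_total (size B) (size C)) => /H//; rewrite setIC.
move=> BC; have takeC x : mkseq x (size C) = C -> mkseq x (size B) = take (size B) C.
  by move=> Cx; rewrite -[in RHS]Cx -map_take take_iota (minn_idPl BC).
have [CB|CB] := eqVneq (take (size B) C) B.
  left; exists C => //; apply/seteqP; split => [x Cx|x []//].
  by split => //; rewrite /cyl /= takeC.
right; apply/seteqP; split => // x [Bx /takeC Cx].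
by move: CB; rewrite -Cx Bx eqxx.
Qed.

Lemma probability_eq_cyl (R : realType) (L : pointedType)
    (m1 m2 : probability (seqSpace L) R) : (forall B, m1 (cyl B) = m2 (cyl B)) ->
  forall A, measurable A -> m1 A = m2 A.
Proof.
move=> m12 A mA.
apply: (@g_sigma_algebra_measure_unique _ R (seqSpace L) (@cylinders L `|` [set set0])
   _ (fun=> setT)).
- by move=> _ [[B _ <-]|->] //; exact: cyl_measurable.
- by move=> _; left; exists [::] => //; apply/seteqP; split.
- by apply/seteqP; split => // x _; exists 0%N.
- exact: cylinders0_setI_closed.
- by move=> _ [[B _ <-]|->]; [exact: m12|rewrite [LHS]measure0 [RHS]measure0].
- by move=> _; apply: (@le_lt_trans _ _ 1%E); [exact: probability_le1|exact: ltry].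
- by apply: sub_sigma_algebra2 mA => B cB; left.
Qed.

(** The shift preimage of [cyl B] is the disjoint union of the two longer cylinders, so [nu] and its
    image under the shift agree on cylinders. *)
Lemma shift_invariant_cyl (R : realType) (nu : probability (seqSpace bool) R) :
  (forall B, nu (cyl B) = nu (cyl (false :: B)) + nu (cyl (true :: B)))%E ->
  shift_invariant nu.
Proof.
move=> nuS.
have cbool : countable [set: bool] by exact: countableP.
have shiftE B : @Defs.shift bool @^-1` cyl B = cyl (false :: B) `|` cyl (true :: B).
  have E (x : nat -> bool) : mkseq x (size B).+1 = x 0%N :: mkseq (Defs.shift x) (size B).
    by rewrite /mkseq /= -add1n iotaDl -map_comp.
  apply/seteqP; split => x; rewrite /cyl /= E.
    by move=> ->; case: (x 0%N); [right|left].
  by case=> [[_ ->]|[_ ->]].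
have mS : (@Defs.shift bool : seqSpace bool -> seqSpace bool) \in mfun.
  rewrite inE.
  apply: (@measurability _ _ (seqSpace bool) (seqSpace bool) setT _ (@cylinders bool)) => //.
  move=> _ [_ [B _ <-] <-]; rewrite setTI shiftE.
  by apply: measurableU; exact: cyl_measurable.
move=> A mA; apply: (probability_eq_cyl (m1 := distribution nu (mfun_Sub mS))) => // B.
rewrite nuS -measureU; [|exact: cyl_measurable|exact: cyl_measurable|].
  by rewrite -shiftE.
by apply/seteqP; split => // x; rewrite /cyl /= => -[[x0 _] []]; rewrite x0.
Qed.

(** * Limits along an ultrafilter *)

(** Compactness gives a cluster point; an ultrafilter contains every set or its complement, so it
    converges to its cluster points. *)
Lemma ultra_cvg_compact (T : topologicalType) (I : Type) (U : set_system I)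
    (f : I -> T) (K : set T) :
  UltraFilter U -> compact K -> (forall i, K (f i)) ->
  exists q, K q /\ f i @[i --> U] --> q.
Proof.
move=> uU cK fK; have UU := @ultra_proper _ _ uU.
have fUK : (f @ U) K by apply: (@filterS _ U _ setT) => [i _|]; [exact: fK|exact: filterT].
have [q [Kq clq]] := cK (f @ U) (fmap_proper_filter f UU) fUK; exists q; split => // V qV.
have [//|UC] := in_ultra_setVsetC (f @^-1` V) uU.
have [x [Vx CVx]] := clq (~` V) V UC qV.
by case: Vx.
Qed.

Lemma block_freq_itv (R : realType) (L : eqType) (x : nat -> L) B n :
  `[0, 1]%classic (block_freq R x B n).
Proof.
rewrite /= in_itv/= /block_freq divr_ge0//=.
have [->|n0] := posnP n; first by rewrite invr0 mulr0.
rewrite ler_pdivrMr ?ltr0n// mul1r ler_nat -[leqRHS]card_ord -sum1_card.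
by apply: leq_sum => i _; exact: leq_b1.
Qed.

Lemma occurs_rcons (x : nat -> bool) B i :
  (occurs x B i = occurs x (rcons B false) i + occurs x (rcons B true) i :> nat)%N.
Proof.
rewrite /occurs !size_rcons /mkseq -(addn1 (size B)) !iotaD !map_cat /= add0n !cats1 !eqseq_rcons.
by case: eqP; case: (x _).
Qed.

Lemma occurs_cons (x : nat -> bool) B i :
  (occurs x (false :: B) i + occurs x (true :: B) i = occurs x B i.+1 :> nat)%N.
Proof.
have E c : occurs x (c :: B) i = (x i == c) && occurs x B i.+1.
  rewrite /occurs /mkseq /= addn0 eqseq_cons -add1n iotaDl -map_comp; congr (_ && (_ == _)).
  by apply: eq_map => k /=; rewrite addnA addn1.
by rewrite !E; case: (x i); case: occurs.
Qed.

Lemma occurs_changes (x : nat -> bool) i :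
  (occurs x [:: false; true] i + occurs x [:: true; false] i = (x i != x i.+1) :> nat)%N.
Proof.
rewrite /occurs /mkseq /= addn0 addn1.
by case: (x i); case: (x i.+1).
Qed.

(** Provides the sequence that [quasi_generated] asks for, diagonally: at stage [k], pick a later
    index where the first [k] functions are within [1 / (k + 1)] of their limits. *)
Lemma ultra_limit_subsequence (R : realType) (U : set_system nat)
    (f : nat -> nat -> R) (q : nat -> R) :
  ProperFilter U -> \oo `<=` U -> (forall m, f m n @[n --> U] --> q m) ->
  exists nk : nat -> nat, {homo nk : a b / (a < b)%N} /\
    forall m, f m (nk k) @[k --> \oo] --> q m.
Proof.
move=> UU ooU fq.
have H k N : exists n, (N < n)%N /\ forall m, (m < k)%N -> `|q m - f m n| <= k.+1%:R^-1.
  have : U [set n | (N < n)%N /\ forall m, (m < k)%N -> `|q m - f m n| <= k.+1%:R^-1].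
    apply: filterI; first by apply: ooU; exists N.+1.
    have k0 : 0 < k.+1%:R^-1 :> R by rewrite invr_gt0.
    elim: {1}k => [|j IH]; first by apply: (@filterS _ U _ setT) => //; exact: filterT.
    have /cvgrPdist_le/(_ _ k0) fj := fq j.
    apply: filterS (filterI IH fj) => n [IHn jn] m; rewrite ltnS leq_eqVlt.
    by move=> /orP[/eqP -> //|/IHn].
  by move=> /filter_ex.
pose next k N := projT1 (cid (H k N)).
have nextP k N : (N < next k N)%N /\
    forall m, (m < k)%N -> `|q m - f m (next k N)| <= k.+1%:R^-1.
  exact: (projT2 (cid (H k N))).
pose nk := fix nk k := if k is j.+1 then next j.+1 (nk j) else next 0%N 0%N.
have nkS k : (nk k < nk k.+1)%N by exact: (nextP k.+1 (nk k)).1.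
have nkP k m : (m < k)%N -> `|q m - f m (nk k)| <= k.+1%:R^-1.
  by case: k => // k; exact: (nextP k.+1 (nk k)).2.
exists nk; split; first exact: homo_ltn ltn_trans nkS.
move=> m; apply/cvgrPdist_le => e e0.
have inv0 : k.+1%:R^-1 @[k --> \oo] --> (0 : R) by exact: cvg_harmonic.
have /cvgrPdist_le/(_ e e0) inve := inv0.
near=> k; apply: le_trans (nkP k m _) _; first by near: k; exact: nbhs_infty_gt.
have : `|0 - k.+1%:R^-1| <= e :> R by near: k.
by rewrite sub0r normrN ger0_norm// invr_ge0.
Unshelve. all: by end_near. Qed.

(** * Superficial sets change value rarely *)

Lemma superficial_changes (R : realType) (S : nat -> bool) :
  superficial R S -> sublinear (fun n => (changes S n)%:R : R).
Proof.
move=> supS; apply: contrapT => nsub.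
have [e e0 eP] : exists2 e : R, 0 < e &
    forall C, exists n, e * n%:R + C < (changes S n)%:R.
  apply: contrapT => h; apply: nsub => e e0; apply: contrapT => h'; apply: h.
  exists e => // C; apply: contrapT => /forallNP h; apply: h'; exists C => n.
  by rewrite normr_nat leNgt; exact/negP/h.
pose A := [set n | e * n%:R < (changes S n)%:R].
have chn n : (changes S n <= n)%N.
  by rewrite -[leqRHS]card_ord -sum1_card leq_sum// => i _; exact: leq_b1.
have WP : ProperFilter (within A \oo).
  apply: Build_ProperFilter.
  (* Taking [C] to be [N] yields a bad time past [N], since there are at most [n] changes below
     [n]. *)
  move=> [N _ NP]; have [n nP] := eP N%:R.
  have nA : A n by apply: le_lt_trans nP; rewrite lerDl.
  apply: (NP n) nA => /=; rewrite -(ler_nat R).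
  apply: (@le_trans _ _ (changes S n)%:R); last by rewrite ler_nat.
  by apply: ltW; apply: le_lt_trans nP; rewrite lerDr mulr_ge0// ltW.
have [U [uU WU]] := ultraFilterLemma WP.
have UU := @ultra_proper _ _ uU.
have ooU : \oo `<=` U by move=> P oP; apply: WU; apply: filterS oP => n Pn _.
have UA : U A by apply: WU; exact: withinT.
have lim_ex B : exists q : R, `[0, 1]%classic q /\ block_freq R S B n @[n --> U] --> q.
  exact: ultra_cvg_compact uU (segment_compact (a := 0) (b := 1)) (@block_freq_itv R _ S B).
pose p B := projT1 (cid (lim_ex B)).
have p01 B : 0 <= p B <= 1.
  by have [+ _] := projT2 (cid (lim_ex B)); rewrite /= in_itv.
have pcvg B : block_freq R S B n @[n --> U] --> p B by have [_] := projT2 (cid (lim_ex B)).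
have uniqU (f : nat -> R) (a b : R) : f n @[n --> U] --> a -> f n @[n --> U] --> b -> a = b.
  by move=> fa fb; apply: cvg_unique fa fb.
have Ugt0 : \forall n \near U, (0 < n)%N by apply: ooU; exists 1%N.
have p_nil : p [::] = 1.
  apply: (uniqU _ _ _ (pcvg [::])); apply: cvg_near_cst.
  apply: filterS Ugt0 => n n0; rewrite /block_freq block_countE.
  by rewrite sum_nat_const card_ord muln1 divff// pnatr_eq0 -lt0n.
have p_rcons B : p B = p (rcons B false) + p (rcons B true).
  apply: (uniqU _ _ _ (pcvg B)).
  suff -> : block_freq R S B =
      block_freq R S (rcons B false) + block_freq R S (rcons B true) :> (nat -> R).
    exact: cvgD.
  apply/funext => n; rewrite fctE /block_freq -mulrDl -natrD !block_countE -big_split/=.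
  by congr (_%:R / _); apply: eq_bigr => i _; rewrite occurs_rcons.
have p_cons B : p B = p (false :: B) + p (true :: B).
  (* Prefixing a letter moves occurrences back by one place, so the counts differ only by the
     boundary term [d n], bounded by 1. *)
  pose d n : R := (occurs S B n)%:R - (occurs S B 0)%:R.
  have dU : d n / n%:R @[n --> U] --> (0 : R).
    suff /sublinearP h : sublinear d by move=> V V0; apply: ooU; exact: h V0.
    apply: (@sublinear_le _ _ (fun=> 1)); last exact: sublinear_cst.
    by move=> n; rewrite /d normr1; do 2 case: occurs; rewrite ler_norml /=; lra.
  apply: (uniqU (block_freq R S (false :: B) + block_freq R S (true :: B) : nat -> R));
    last exact: cvgD.
  suff -> : (block_freq R S (false :: B) + block_freq R S (true :: B) : nat -> R) =
      block_freq R S B + (fun n => d n / n%:R) :> (nat -> R).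
    by rewrite -[p B]addr0; exact: cvgD.
  apply/funext => n; rewrite !fctE /block_freq -!mulrDl; congr (_ / _).
  rewrite /d addrA -natrD !block_countE -big_split/=; apply/eqP.
  rewrite eq_sym subr_eq -!natrD; apply/eqP; congr (_%:R).
  under [in RHS]eq_bigr do rewrite occurs_cons.
  have : (\sum_(i < n.+1) occurs S B i = \sum_(i < n) occurs S B i + occurs S B n)%N.
    exact: big_ord_recr.
  by rewrite big_ord_recl /= addnC => ->.
(* Occurrences of [01] and [10] together count the changes, more than [e * n] of them at the times
   in [A]. *)
have p_changes : e <= p [:: false; true] + p [:: true; false].
  apply: (cvgr_to_ge (cvgD (pcvg [:: false; true]) (pcvg [:: true; false]))).
  apply: filterS (filterI UA Ugt0) => n [An n0].
  rewrite /block_freq !fctE -mulrDl -natrD !block_countE -big_split/=.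
  under eq_bigr do rewrite occurs_changes.
  by rewrite ler_pdivlMr ?ltr0n// ltW.
have [nu nuP] := consistent_probability (fun B => (andP (p01 B)).1) p_nil p_rcons.
have [b bP] := seq_enumeration (countableP [set: bool]).
have [nk [nk_incr nkP]] := ultra_limit_subsequence UU ooU (fun m => pcvg (b m)).
have [] := supS nu.
- by apply: shift_invariant_cyl => B; rewrite !nuP -EFinD -p_cons.
- exists nk; split => // B; have [m <-] := bP B.
  by rewrite nuP; exact: nkP.
move=> t [_ tP].
(* No constant sequence begins with [01] or [10], so both point masses vanish on these cylinders. *)
have nu0 B : B = [:: false; true] \/ B = [:: true; false] -> p B = 0.
  move=> hB; have := tP _ (cyl_measurable B); rewrite nuP !diracE.
  rewrite !memNset ?mule0 ?adde0; first by case.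
    by move: hB => [->|->].
  by move: hB => [->|->].
by move: p_changes; rewrite !nu0; [lra|right|left].
Qed.

Unset Implicit Arguments. Set Strict Implicit. Set Printing Implicit Defensive.

(* S : nat -> bool is the indicator of S; s is the increasing enumeration
   s_1 < s_2 < ... of S, so that x|_S = x \o s. *)
Theorem mainTheorem2 (R : realType) (L : pointedType)
  (hL : countable [set: L]) (h2 : exists a b : L, a <> b)
  (mu : probability (seqSpace L) R) (hmu : shift_invariant mu)
  (S : nat -> bool) (s : nat -> nat)
  (hs_incr : {homo s : a b / (a < b)%N})
  (hs_range : forall n, S n <-> exists k, s k = n) :
  superficial R S ->
  exists x : nat -> L, generic mu x /\ generic mu (x \o s).
Proof.
move=> supS; have [z gz] := exists_generic hL hmu.
exists (spread S z); split; first exact: generic_spread (superficial_changes supS) gz.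
(* [s k] has rank [k] in [S], so restricting to [S] gives back [z] itself. *)
suff -> : spread S z \o s = z by [].
by apply/funext => k; rewrite /= /spread class_rank_enum.
Qed.
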